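(* Let $H\in(0,1)$, $K\in(0,1]$, $\alpha>0$, and let $$R_{B,\alpha}(t)=2^{-K}e^{-\alpha HK t}\Bigl((e^{2\alpha H t}+1)^{K}-|e^{\alpha t}-1|^{2HK}\Bigr),\qquad t\in\mathbb{R}.$$ Then there exists a constant $c(H,K,\alpha)>0$ such that $$R_{B,\alpha}(t)=O\bigl(e^{-c(H,K,\alpha)t}\bigr),\qquad t\to\infty.$$ In particular $\lim_{t\to\infty}R_{B,\alpha}(t)=0$.
   Context: The function $R_{B,\alpha}$ is the autocovariance function of the stationary process $B_{H,K}^{\mathrm{LT}}(t)=e^{-\alpha HKt}B_{H,K}(e^{\alpha t})$, $t\in\mathbb{R}$, where $B_{H,K}$ is bi-fractional Brownian motion, i.e. the centred Gaussian process on $[0,\infty)$ with covariance $2^{-K}((t^{2H}+s^{2H})^{K}-|t-s|^{2HK})$. *)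

(* Defs.v *)
From mathcomp Require Import all_boot all_order all_algebra.
From mathcomp Require Import all_classical all_reals all_analysis.

Set Implicit Arguments.
Unset Strict Implicit.
Unset Printing Implicit Defensive.

Import Order.TTheory GRing.Theory Num.Theory.
Import numFieldNormedType.Exports.

Local Open Scope ring_scope.

(* At t = 0 the term with exponent 2HK is 0 `^ (2HK), which [powR] evaluates
   to 0 whenever HK != 0. *)
Definition R_B {R : realType} (H K alpha t : R) : R :=
  2 `^ (- K) * expR (- (alpha * H * K * t)) *
  ((expR (2 * alpha * H * t) + 1) `^ K
   - `|expR (alpha * t) - 1| `^ (2 * H * K)).

(* Missing from the library, and needed to write f =O_ +oo_R g: the Landau
   notations take their filter as a canonical [filter_on]. *)
Canonical pinfty_nbhs_filter_on (R : numFieldType) :=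
  FilterType (pinfty_nbhs R) _.

(* Main.v *)
(** With x = e^(-alpha t), factoring e^(2 alpha H K t) out of the bracket gives
    R(t) = 2^(-K) x^(-HK) ((1 + x^(2H))^K - (1 - x)^(2HK)).  For 0 < x < 1 one
    has (1 - x)^(2HK) <= 1 <= (1 + x^(2H))^K, and, since K <= 1 and HK <= 1,
    (1 + x^(2H))^K <= 1 + x^(2H) and (1 - x)^(2HK) >= (1 - x)^2 >= 1 - 2x.
    Hence 0 <= R(t) <= x^(H(2 - K)) + 2 x^(1 - HK), and both exponents are
    positive. *)
Require Import Defs.
From mathcomp Require Import all_boot all_order all_algebra.
From mathcomp Require Import all_classical all_reals all_analysis.
From mathcomp Require Import ring lra.
Import Order.TTheory GRing.Theory Num.Theory.
Import numFieldNormedType.Exports.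
Local Open Scope classical_set_scope.
Local Open Scope ring_scope.

(** The sign condition removes the absolute value. The factors [expR (2 * alpha * H * t)] and
    [expR (alpha * t)], taken out of their powers, both become e^(2 alpha H K t). *)
Lemma R_BE (R : realType) (H K alpha t : R) : 0 <= alpha * t ->
  R_B H K alpha t = 2 `^ (- K) * expR (alpha * H * K * t) *
    ((1 + expR (- (2 * alpha * H * t))) `^ K
     - (1 - expR (- (alpha * t))) `^ (2 * H * K)).
Proof.
move=> at_ge0.
have x_le1 : expR (- (alpha * t)) <= 1 by rewrite -expR0 ler_expR oppr_le0.
have -> : R_B H K alpha t = 2 `^ (- K) * expR (- (alpha * H * K * t)) *
    ((expR (2 * alpha * H * t) * (1 + expR (- (2 * alpha * H * t)))) `^ K
     - (expR (alpha * t) * (1 - expR (- (alpha * t)))) `^ (2 * H * K)).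
  rewrite [expR _ * (1 + _)]mulrDr [expR _ * (1 - _)]mulrBr -!expRD !subrr.
  by rewrite expR0 !mulr1 /R_B ger0_norm // subr_ge0 -expR0 ler_expR.
rewrite !powRM ?expR_ge0 ?subr_ge0 ?addr_ge0 ?expR_ge0 // -!expRM.
have -> : alpha * t * (2 * H * K) = 2 * alpha * H * t * K by ring.
rewrite -mulrBr mulrA -[X in X * _ = _]mulrA -expRD.
by congr (_ * expR _ * _); ring.
Qed.

(** Powers are monotone in the exponent: increasing for the base [1 + u], decreasing for [1 - x].
    Each is compared with its values at the endpoint exponents, 0 and 1 or 0 and 2. *)
Lemma powR_bracket_bounds (R : realType) (u x p K : R) :
  0 <= u -> 0 <= x < 1 -> 0 <= p <= 2 -> 0 <= K <= 1 ->
  0 <= (1 + u) `^ K - (1 - x) `^ p <= u + 2 * x.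
Proof.
move=> u0 /andP[x0 x1] /andP[p0 p2] /andP[K0 K1].
have u1 : 1 <= 1 + u by lra.
have y01 : 0 < 1 - x <= 1 by lra.
have lo1 : 1 <= (1 + u) `^ K by rewrite -[leLHS](powRr0 (1 + u)) ler_powR.
have hi1 : (1 + u) `^ K <= 1 + u by exact: ler1_powR.
have lo2 : (1 - x) ^+ 2 <= (1 - x) `^ p.
  by rewrite -powR_mulrn ?ger_powR //; lra.
have hi2 : (1 - x) `^ p <= 1 by rewrite -[leRHS](powRr0 (1 - x)) ger_powR.
by apply/andP; split; nra.
Qed.

Lemma R_B_bounds (R : realType) (H K alpha c t : R) :
  0 < H <= 1 -> 0 < K <= 1 -> 0 < alpha -> 0 < t ->
  c <= alpha * (H * (2 - K)) -> c <= alpha * (1 - H * K) ->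
  0 <= R_B H K alpha t <= 3 * expR (- c * t).
Proof.
move=> /andP[H0 H1] /andP[K0 K1] a0 t0 c1 c2.
have at0 : 0 < alpha * t by exact: mulr_gt0.
rewrite (R_BE _ _ _ _ _ (ltW at0)).
set u := expR (- (2 * _ * _ * _)); set x := expR (- (alpha * t)).
have x01 : 0 <= x < 1 by rewrite expR_ge0 /= -expR0 ltr_expR oppr_lt0.
have p02 : 0 <= 2 * H * K <= 2 by apply/andP; split; nra.
have K01 : 0 <= K <= 1 by rewrite K1 ltW.
have u0 : 0 <= u by exact: expR_ge0.
have /andP[lo hi] := powR_bracket_bounds _ _ _ _ _ u0 x01 p02 K01.
have s0 : 0 <= 2 `^ (- K) :> R by exact: powR_ge0.
have s1 : 2 `^ (- K) <= 1 :> R.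
  by rewrite -[leRHS](powRr0 2) ler_powR ?oppr_le0 ?(ltW K0) // ler1n.
have e0 := expR_ge0 (alpha * H * K * t).
apply/andP; split; first by rewrite !mulr_ge0.
(* The two summands decay at the rates alpha H (2 - K) and alpha (1 - H K), both at least [c]; their
   coefficients 1 and 2 add up to the constant 3. *)
apply: (@le_trans _ _ (expR (alpha * H * K * t) * (u + 2 * x))).
  by apply: ler_pM; rewrite ?mulr_ge0 ?ler_piMl.
have ux : expR (alpha * H * K * t) * u <= expR (- c * t).
  by rewrite -expRD ler_expR; nra.
have xx : expR (alpha * H * K * t) * x <= expR (- c * t).
  by rewrite -expRD ler_expR; nra.
lra.
Qed.

Theorem lemma2p15 (R : realType) (H K alpha : R)
    (H_gt0 : 0 < H) (H_lt1 : H < 1) (K_gt0 : 0 < K) (K_le1 : K <= 1)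
    (alpha_gt0 : 0 < alpha) :
  (exists2 c : R, 0 < c &
    (R_B H K alpha : R -> R^o) =O_ (+oo_R) ((fun t => expR (- c * t)) : R -> R^o))
  /\ R_B H K alpha t @[t --> +oo_R] --> (0 : R).
Proof.
(* The slower of the two decay rates; the second is positive because H < 1 and K <= 1 give H K <
   1. *)
pose c := Num.min (alpha * (H * (2 - K))) (alpha * (1 - H * K)).
have c_gt0 : 0 < c by rewrite lt_min !mulr_gt0 //=; nra.
have bounds : \forall t \near +oo_R,
    0 <= R_B H K alpha t <= 3 * expR (- c * t).
  near=> t; apply: R_B_bounds; rewrite ?H_gt0 ?K_gt0 ?(ltW H_lt1) //.
  - by rewrite ge_min lexx.
  - by rewrite ge_min lexx orbT.
split.
  exists c => //; apply/eqO_exP; exists 3 => //.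
  apply: filterS bounds => t /andP[lo hi].
  by rewrite !ger0_norm ?expR_ge0.
(* The same bounds squeeze the function between 0 and a decaying exponential. *)
apply: (squeeze_cvgr bounds); first exact: cvg_cst.
rewrite -(mulr0 (3 : R)); apply: cvgMr.
have ct : c * t @[t --> +oo_R] --> +oo_R by apply: gt0_cvgMry.
under eq_fun do rewrite mulNr.
exact: cvg_comp ct (@cvgr_expR R).
Unshelve. all: by end_near. Qed.
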